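(* Let $R$ be a commutative ring with a unit element, $\operatorname{char}R=\ell$, where either $\ell$ is an odd natural number or $\ell=0$, and let $G_R$ be the Grassmann algebra over $R$. Then all polynomials from $P_n(\mathbb Z)\cap\operatorname{Id}(G_R,\mathbb Z)$, $n\in\mathbb N$, are consequences of the left hand sides of the following polynomial identities in $G_R$: $$[x,y,z]\equiv0,\qquad \ell x\equiv0.$$ Moreover, as abelian groups, $\frac{P_n(\mathbb Z)}{P_n(\mathbb Z)\cap\operatorname{Id}(G_R,\mathbb Z)}\cong(\mathbb Z_\ell)^{2^{n-1}}$.
   Context: $\mathbb N=\{1,2,\dots\}$; $\mathbb Z_\ell=\mathbb Z/\ell\mathbb Z$, $\mathbb Z_0=\mathbb Z$. $\operatorname{char}R$ is the least $n\in\mathbb N$ with $n1_R=0$, or $0$ if there is none. The Grassmann algebra $G_R$ is the (associative) $R$-algebra with unit generated by the countable set of generators $e_i$, $i\in\mathbb N$, subject to the anti-commutative relations $e_ie_j=-e_je_i$, $i,j\in\mathbb N$. $\mathbb Z\langle X\rangle$ is the free associative ring without $1$ on $X=\{x_1,x_2,\dots\}$ ($x,y,z$ are distinct variables); $[x,y]=xy-yx$, $[x,y,z]=[[x,y],z]$. For a ring $A$, $\operatorname{Id}(A,\mathbb Z)\subseteq\mathbb Z\langle X\rangle$ is the set of $f$ with $f(a_1,\dots,a_n)=0$ for all $a_i\in A$. $P_n(\mathbb Z)$ is the additive subgroup of $\mathbb Z\langle X\rangle$ generated by $x_{\sigma(1)}\cdots x_{\sigma(n)}$, $\sigma\in S_n$.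 A T-ideal of $\mathbb Z\langle X\rangle$ is an ideal invariant under all ring endomorphisms of $\mathbb Z\langle X\rangle$; a polynomial is a consequence of given polynomials if it lies in the T-ideal they generate. *)

(* Defs.v *)
From HB Require Import structures.
From mathcomp Require Import all_boot all_order all_algebra perm.
From mathcomp Require Import finmap.
From mathcomp Require Import boolp.
From mathcomp Require Import monalg.

Set Implicit Arguments.
Unset Strict Implicit.
Unset Printing Implicit Defensive.

Import GRing.Theory.

Local Open Scope ring_scope.
Local Open Scope quotient_scope.

(* As the characteristic is the least n >= 1 with n 1_R = 0, the zero ring has
   characteristic 1; hence rings are taken in pzRingType rather than in
   nzRingType, which would exclude it. *)
Definition has_char (R : pzRingType) (l : nat) : Prop :=
  [/\ (0 < l)%N, l%:R = 0 :> R
    & forall m, (0 < m < l)%N -> m%:R <> 0 :> R]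
  \/ l = 0%N /\ forall m, (0 < m)%N -> m%:R <> 0 :> R.

(* The Grassmann algebra over R, given by its presentation: terms in the
   language of unital R-algebras on the generators e_i, modulo the least
   congruence containing the axioms of associative unital R-algebras and the
   relations e_i e_j = - e_j e_i for all i, j (the case i = j, which only says
   that 2 e_i^2 = 0, is included). {malg R[K]} and algType R are not usable here: they
   require nontrivial rings, and R may be the zero ring. *)
Inductive gterm (R : Type) : Type :=
  | GGen of nat
  | GZero
  | GOpp of gterm R
  | GAdd of gterm R & gterm R
  | GOne
  | GMul of gterm R & gterm R
  | GScale of R & gterm R.

Arguments GGen {R}.
Arguments GZero {R}.
Arguments GOne {R}.

HB.instance Definition _ (R : Type) := gen_eqMixin (gterm R).
HB.instance Definition _ (R : Type) := gen_choiceMixin (gterm R).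

Section Grassmann.
Variable R : comPzRingType.
Implicit Types (a b : R) (t u v : gterm R).

Inductive gcong : gterm R -> gterm R -> Prop :=
  | gcong_refl t : gcong t t
  | gcong_sym t u : gcong t u -> gcong u t
  | gcong_trans t u v : gcong t u -> gcong u v -> gcong t v
  | gcong_opp t t' : gcong t t' -> gcong (GOpp t) (GOpp t')
  | gcong_add t t' u u' :
      gcong t t' -> gcong u u' -> gcong (GAdd t u) (GAdd t' u')
  | gcong_mul t t' u u' :
      gcong t t' -> gcong u u' -> gcong (GMul t u) (GMul t' u')
  | gcong_scale a t t' : gcong t t' -> gcong (GScale a t) (GScale a t')
  | gcong_addA t u v : gcong (GAdd t (GAdd u v)) (GAdd (GAdd t u) v)
  | gcong_addC t u : gcong (GAdd t u) (GAdd u t)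
  | gcong_add0 t : gcong (GAdd GZero t) t
  | gcong_addN t : gcong (GAdd (GOpp t) t) GZero
  | gcong_mulA t u v : gcong (GMul t (GMul u v)) (GMul (GMul t u) v)
  | gcong_mul1l t : gcong (GMul GOne t) t
  | gcong_mul1r t : gcong (GMul t GOne) t
  | gcong_mulDl t u v :
      gcong (GMul (GAdd t u) v) (GAdd (GMul t v) (GMul u v))
  | gcong_mulDr t u v :
      gcong (GMul t (GAdd u v)) (GAdd (GMul t u) (GMul t v))
  | gcong_scaleA a b t : gcong (GScale a (GScale b t)) (GScale (a * b) t)
  | gcong_scale1 t : gcong (GScale 1 t) t
  | gcong_scaleDr a t u :
      gcong (GScale a (GAdd t u)) (GAdd (GScale a t) (GScale a u))
  | gcong_scaleDl a b t :
      gcong (GScale (a + b) t) (GAdd (GScale a t) (GScale b t))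
  | gcong_scaleAl a t u : gcong (GScale a (GMul t u)) (GMul (GScale a t) u)
  | gcong_scaleAr a t u : gcong (GScale a (GMul t u)) (GMul t (GScale a u))
  | gcong_anticomm i j :
      gcong (GMul (GGen i) (GGen j)) (GOpp (GMul (GGen j) (GGen i))).

Definition gcongb t u : bool := `[< gcong t u >].

Lemma gcongb_refl : reflexive gcongb.
Proof. by move=> t; apply/asboolP/gcong_refl. Qed.

Lemma gcongb_sym : symmetric gcongb.
Proof. by move=> t u; apply/asboolP/asboolP => /gcong_sym. Qed.

Lemma gcongb_trans : transitive gcongb.
Proof.
move=> u t v /asboolP tu /asboolP uv; exact/asboolP/(gcong_trans tu uv).
Qed.

Canonical gcong_equiv := EquivRel gcongb gcongb_refl gcongb_sym gcongb_trans.
Canonical gcong_encModRel := defaultEncModRel gcongb.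

Definition grassmann := {eq_quot gcongb}.

HB.instance Definition _ : EqQuotient (gterm R) gcongb grassmann :=
  EqQuotient.on grassmann.
HB.instance Definition _ := Choice.on grassmann.

Definition gpi t : grassmann := \pi_grassmann t.

Lemma gpiP t u : gpi t = gpi u <-> gcong t u.
Proof. by split=> [/eqmodP/asboolP|?] //; apply/eqmodP/asboolP. Qed.

Lemma gpi_repr (x : grassmann) : gpi (repr x) = x.
Proof. exact: reprK. Qed.

Lemma gcong_repr t : gcong (repr (gpi t)) t.
Proof. by apply/gpiP; rewrite gpi_repr. Qed.

Definition gzero : grassmann := gpi GZero.
Definition gone : grassmann := gpi GOne.
Definition gopp (x : grassmann) : grassmann := gpi (GOpp (repr x)).
Definition gadd (x y : grassmann) : grassmann := gpi (GAdd (repr x) (repr y)).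
Definition gmul (x y : grassmann) : grassmann := gpi (GMul (repr x) (repr y)).
Definition gscale a (x : grassmann) : grassmann := gpi (GScale a (repr x)).

Lemma gpi_opp t : gopp (gpi t) = gpi (GOpp t).
Proof. exact/gpiP/gcong_opp/gcong_repr. Qed.

Lemma gpi_add t u : gadd (gpi t) (gpi u) = gpi (GAdd t u).
Proof. by apply/gpiP/gcong_add; apply: gcong_repr. Qed.

Lemma gpi_mul t u : gmul (gpi t) (gpi u) = gpi (GMul t u).
Proof. by apply/gpiP/gcong_mul; apply: gcong_repr. Qed.

Lemma gpi_scale a t : gscale a (gpi t) = gpi (GScale a t).
Proof. exact/gpiP/gcong_scale/gcong_repr. Qed.

Let gpiE := (gpi_opp, gpi_add, gpi_mul, gpi_scale).

Lemma gaddA : associative gadd.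
Proof.
move=> x y z; rewrite -(gpi_repr x) -(gpi_repr y) -(gpi_repr z) !gpiE.
exact/gpiP/gcong_addA.
Qed.

Lemma gaddC : commutative gadd.
Proof. move=> x y; exact/gpiP/gcong_addC. Qed.

Lemma gadd0 : left_id gzero gadd.
Proof. by move=> x; rewrite -(gpi_repr x) gpiE; apply/gpiP/gcong_add0. Qed.

Lemma gaddN : left_inverse gzero gopp gadd.
Proof. by move=> x; rewrite -(gpi_repr x) !gpiE; apply/gpiP/gcong_addN. Qed.

HB.instance Definition _ :=
  GRing.isZmodule.Build grassmann gaddA gaddC gadd0 gaddN.

Lemma gmulA : associative gmul.
Proof.
move=> x y z; rewrite -(gpi_repr x) -(gpi_repr y) -(gpi_repr z) !gpiE.
exact/gpiP/gcong_mulA.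
Qed.

Lemma gmul1l : left_id gone gmul.
Proof. by move=> x; rewrite -(gpi_repr x) gpiE; apply/gpiP/gcong_mul1l. Qed.

Lemma gmul1r : right_id gone gmul.
Proof. by move=> x; rewrite -(gpi_repr x) gpiE; apply/gpiP/gcong_mul1r. Qed.

Lemma gmulDl : left_distributive gmul gadd.
Proof.
move=> x y z; rewrite -(gpi_repr x) -(gpi_repr y) -(gpi_repr z) !gpiE.
exact/gpiP/gcong_mulDl.
Qed.

Lemma gmulDr : right_distributive gmul gadd.
Proof.
move=> x y z; rewrite -(gpi_repr x) -(gpi_repr y) -(gpi_repr z) !gpiE.
exact/gpiP/gcong_mulDr.
Qed.

HB.instance Definition _ := GRing.Zmodule_isPzRing.Build grassmann
  gmulA gmul1l gmul1r gmulDl gmulDr.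

Lemma gscaleA a b x : gscale a (gscale b x) = gscale (a * b) x.
Proof. by rewrite -(gpi_repr x) !gpiE; apply/gpiP/gcong_scaleA. Qed.

Lemma gscale1 : left_id 1 gscale.
Proof. by move=> x; rewrite -(gpi_repr x) gpiE; apply/gpiP/gcong_scale1. Qed.

Lemma gscaleDr : right_distributive gscale +%R.
Proof.
move=> a x y; rewrite -(gpi_repr x) -(gpi_repr y) -[_ + _]/(gadd _ _).
by rewrite -[RHS]/(gadd _ _) !gpiE; apply/gpiP/gcong_scaleDr.
Qed.

Lemma gscaleDl x : {morph gscale^~ x : a b / a + b}.
Proof.
move=> a b; rewrite -(gpi_repr x) -[RHS]/(gadd _ _) !gpiE.
exact/gpiP/gcong_scaleDl.
Qed.

HB.instance Definition _ := GRing.Zmodule_isLmodule.Build R grassmann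
  gscaleA gscale1 gscaleDr gscaleDl.

Lemma gscaleAl a (x y : grassmann) : a *: (x * y) = (a *: x) * y.
Proof.
rewrite -(gpi_repr x) -(gpi_repr y) -[RHS]/(gmul (gscale _ _) _).
by rewrite -[LHS]/(gscale _ (gmul _ _)) !gpiE; apply/gpiP/gcong_scaleAl.
Qed.

Lemma gscaleAr a (x y : grassmann) : a *: (x * y) = x * (a *: y).
Proof.
rewrite -(gpi_repr x) -(gpi_repr y) -[RHS]/(gmul _ (gscale _ _)).
by rewrite -[LHS]/(gscale _ (gmul _ _)) !gpiE; apply/gpiP/gcong_scaleAr.
Qed.

Definition ggen (i : nat) : grassmann := gpi (GGen i).

Lemma ggen_anticomm i j : ggen i * ggen j = - (ggen j * ggen i).
Proof.
rewrite /ggen -[LHS]/(gmul _ _) -[RHS]/(gopp (gmul _ _)) !gpiE.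
exact/gpiP/gcong_anticomm.
Qed.

End Grassmann.

(* Z<X>, the free associative ring without 1, is the augmentation ideal of the
   free unital ring on X: the polynomials without constant term. Variables (and
   the generators e_i above) are numbered from 0 instead of 1. *)
Notation ZX1 := {malg int[{fmonom nat}]}.

Definition noconst : {pred ZX1} := fun f =>
  f@_(mone : {fmonom nat}) == 0.

Lemma noconst_zmod_closed : zmod_closed noconst.
Proof.
split=> [|f g]; rewrite !unfold_in ?mcoeff0 // mcoeffB.
by move=> /eqP-> /eqP->; rewrite subr0.
Qed.
HB.instance Definition _ :=
  GRing.isZmodClosed.Build ZX1 noconst noconst_zmod_closed.

Record ZX := MkZX { zx_val :> ZX1; zx_valP : zx_val \in noconst }.
HB.instance Definition _ := [isSub for zx_val].
HB.instance Definition _ := [Choice of ZX by <:].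
HB.instance Definition _ := [SubChoice_isSubZmodule of ZX by <:].

Lemma zx_valB (f g : ZX) : zx_val (f - g) = zx_val f - zx_val g.
Proof. exact: (raddfB (val : ZX -> ZX1)). Qed.

Lemma noconstM (f g : ZX1) : f \in noconst -> f * g \in noconst.
Proof.
by rewrite !unfold_in => /eqP f0; rewrite rmorphM /= f0 mul0r.
Qed.

Definition zx_mul (f g : ZX) : ZX := MkZX (noconstM (zx_val g) (zx_valP f)).

Lemma noconstX i : (<< fmu i >> : ZX1) \in noconst.
Proof. by rewrite unfold_in mcoeffU fmP fm1 fmuE. Qed.

Definition zx_var (i : nat) : ZX := MkZX (noconstX i).

Definition zx_comm (f g : ZX) : ZX := zx_mul f g - zx_mul g f.

Record is_Tideal (I : ZX -> Prop) : Prop := {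
  Tideal_zero : I 0;
  Tideal_sub : forall f g, I f -> I g -> I (f - g);
  Tideal_mull : forall f g, I g -> I (zx_mul f g);
  Tideal_mulr : forall f g, I f -> I (zx_mul f g);
  Tideal_endo : forall phi : {additive ZX -> ZX},
    {morph phi : f g / zx_mul f g} -> forall f, I f -> I (phi f)
}.

(* f lies in the T-ideal generated by S. *)
Definition consequence (S : ZX -> Prop) (f : ZX) : Prop :=
  forall I, is_Tideal I -> (forall g, S g -> I g) -> I f.

Definition zx_eval (A : pzRingType) (a : nat -> A) (f : ZX) : A :=
  \sum_(w <- msupp (zx_val f)) (\prod_(i <- (w : seq nat)) a i) *~ f@_w.

Definition Id (A : pzRingType) : {pred ZX} :=
  fun f => `[< forall a : nat -> A, zx_eval a f = 0 >].

(* P_n(Z); the product is formed in the unital ring ZX1, whose elements without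
   constant term form Z<X>. *)
Definition P (n : nat) : {pred ZX} := fun f =>
  `[< exists c : 'S_n -> int,
      zx_val f = \sum_(s : 'S_n) (\prod_(i < n) (zx_var (s i) : ZX1)) *~ c s >].

Lemma zx_eval_sum (A : pzRingType) (a : nat -> A) (f : ZX)
    (d : {fset {fmonom nat}}) : (msupp (zx_val f) `<=` d)%fset ->
  zx_eval a f = \sum_(w <- d) (\prod_(i <- (w : seq nat)) a i) *~ f@_w.
Proof.
move=> le_d; rewrite /zx_eval [RHS](big_fsetID _ (mem (msupp (zx_val f)))) /=.
rewrite [X in _ = _ + X]big1_seq ?addr0; last first.
  move=> w /=; rewrite !inE /= => /andP[_ wf].
  by rewrite mcoeff_outdom ?mulr0z.
apply: eq_fbigl => w; rewrite !inE /=.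
by case: (boolP (w \in msupp _)) => [/(fsubsetP le_d)->|_]; rewrite ?andbF.
Qed.

Lemma Id_zmod_closed (A : pzRingType) : zmod_closed (Id A).
Proof.
split=> [|f g /asboolP Hf /asboolP Hg]; apply/asboolP => a.
  by rewrite /zx_eval msupp0 big_seq_fset0.
have -> : zx_eval a (f - g) = zx_eval a f - zx_eval a g; last first.
  by rewrite Hf Hg subr0.
pose d := (msupp (zx_val f) `|` msupp (zx_val g))%fset.
rewrite (@zx_eval_sum A a (f - g) d) ?zx_valB ?msuppB_le //.
rewrite (@zx_eval_sum A a f d) ?fsubsetUl // (@zx_eval_sum A a g d) ?fsubsetUr //.
rewrite -sumrB; apply: eq_bigr => w _.
by rewrite mcoeffB mulrzBr.
Qed.

Lemma P_zmod_closed n : zmod_closed (P n).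
Proof.
split=> [|f g /asboolP[c Hc] /asboolP[c' Hc']]; apply/asboolP.
  by exists (fun=> 0); rewrite big1 // => s _; rewrite mulr0z.
exists (fun s => c s - c' s); rewrite zx_valB Hc Hc' -sumrB.
by apply: eq_bigr => s _; rewrite mulrzBr.
Qed.
HB.instance Definition _ n :=
  GRing.isZmodClosed.Build ZX (P n) (P_zmod_closed n).

Definition P_group (n : nat) := {f : ZX | f \in P n}.
HB.instance Definition _ n := SubChoice.on (P_group n).
HB.instance Definition _ n := [SubChoice_isSubZmodule of P_group n by <:].

(* P_n(Z) \cap Id(A, Z), as a subgroup of P_n(Z). *)
Definition P_Id (A : pzRingType) (n : nat) : {pred P_group n} :=
  fun f => val f \in [predI P n & Id A].

Lemma P_Id_zmod_closed (A : pzRingType) n : zmod_closed (@P_Id A n).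
Proof.
have [I0 IB] := Id_zmod_closed A.
have [P0 PB] := P_zmod_closed n.
split=> [|f g /andP[Pf If] /andP[Pg Ig]]; apply/andP; split=> //=.
  exact: PB.
exact: IB.
Qed.
HB.instance Definition _ (A : pzRingType) n :=
  GRing.isZmodClosed.Build (P_group n) (@P_Id A n) (@P_Id_zmod_closed A n).

Definition P_quot (A : pzRingType) (n : nat) : zmodType :=
  Quotient.quot (@P_Id A n).

(* Z_l as an additive group; 'I_m.+1 carries addition modulo m.+1 (also for
   m = 0), whereas 'Z_l would be wrong for l < 2. *)
Definition Zmod (l : nat) : zmodType := if l is m.+1 then 'I_m.+1 else int.

(* Main.v *)
Require Import Defs.
From HB Require Import structures.
From mathcomp Require Import all_boot all_order all_algebra perm.
From mathcomp Require Import finmap boolp monalg.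

(** In the Grassmann algebra every element is a sum of an even and an odd one,
even elements are central and odd ones anticommute; hence a commutator is even,
so central, which is the identity [x,y,z] = 0.

In any ring where commutators are central, expanding the zero element
[[xy, z], t] gives [x,z][y,t] = - [x,t][y,z] ([lie_swap]), so a product of
commutators [x1,x2][x3,x4]... only changes sign when its entries are permuted
([comm_prod_swap]). Sorting a multilinear word by adjacent transpositions, at
the cost of one new central commutator for each of them, therefore writes it as
an integer combination of the elements
   b_K = (product of the x_i, i not in K, in increasing order)
         * [x_k1, x_k2][x_k3, x_k4]...      (K = {k1 < k2 < ...} of even size),
which are 2^(n-1) in number ([word_comm_basis_span], [card_evenset]). The
coefficients do not depend on the ring: the same ones serve for the quotient of
the free ring by any T-ideal containing [x,y,z], and for the Grassmann algebra.

Conversely, evaluate a combination of the b_K at x_i = e_i for i in J and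
x_i = 1 for the other i. A commutator with an entry 1 vanishes, so only the b_K
with K included in J survive, and b_J becomes 2^(|J|/2) e_J since
[e_i,e_j] = 2 e_i e_j. By induction on |J|, if the combination is an identity
then l divides 2^(|J|/2) c_J, hence c_J as l is odd or zero ([basis_free]). This
uses that m e_J = 0 only if m = 0 in R ([prod_gen_free]), which is seen on a
concrete representation of the Grassmann algebra by annihilation operators.

So the combinations of the b_K that are identities are exactly those whose
coefficients are all divisible by l. They are consequences of l x = 0, which
proves the first claim, and the b_K identify the quotient of P_n with a power of
Z/l, which proves the second. *)

Set Implicit Arguments.
Unset Strict Implicit.
Unset Printing Implicit Defensive.

Import GRing.Theory.
Local Open Scope ring_scope.

(** * Rings with central commutators *)

Section Lie.
Context {Q : pzRingType}.
Implicit Types x y z t : Q.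

Definition lie x y := x * y - y * x.

Lemma lieDl x y z : lie (x + y) z = lie x z + lie y z.
Proof. by rewrite /lie mulrDl mulrDr opprD addrACA. Qed.

Lemma lieC x y : lie x y = - lie y x.
Proof. by rewrite /lie opprB. Qed.

Lemma lieDr x y z : lie x (y + z) = lie x y + lie x z.
Proof. by rewrite lieC lieDl opprD -!lieC. Qed.

Lemma lieMl x y z : lie (x * y) z = x * lie y z + lie x z * y.
Proof. by rewrite /lie mulrBr mulrBl !mulrA addrA subrK. Qed.

Lemma lie_intl (m : int) x : lie m%:~R x = 0.
Proof. by rewrite /lie mulrzl mulrzr subrr. Qed.

Lemma lie1 x : lie 1 x = 0.
Proof. exact: (lie_intl 1). Qed.

Lemma lie_eq0 x y : lie x y = 0 -> x * y = y * x.
Proof. exact: subr0_eq. Qed.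

End Lie.

Definition lie_nilpotent2 (Q : pzRingType) :=
  forall x y z : Q, lie (lie x y) z = 0.

(** The product [x1,x2][x3,x4]... of the consecutive commutators; a last unpaired
entry is dropped, so that only lists of even length are meaningful. *)
Fixpoint comm_prod {Q : pzRingType} (s : seq Q) : Q :=
  if s is x :: y :: s' then lie x y * comm_prod s' else 1.

Lemma seq_ind2 (T : Type) (p : seq T -> Prop) :
  p [::] -> (forall x, p [:: x]) ->
  (forall x y s, p s -> p (x :: y :: s)) -> forall s, p s.
Proof.
move=> p0 p1 p2 s; suff: p s /\ forall x, p (x :: s) by case.
by elim: s => [|x s [ps pxs]]; split=> // y; apply: p2.
Qed.

Section LieNilpotent.
Context {Q : pzRingType}.
Hypothesis nilQ : lie_nilpotent2 Q.
Implicit Types x y z t : Q.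

(** Both sides come from the expansion of the commutator of [xy, z] with t, in
which the terms containing a triple commutator vanish. *)
Lemma lie_swap x y z t : lie x z * lie y t = - (lie x t * lie y z).
Proof.
apply/eqP; rewrite -addr_eq0 addrC; apply/eqP; rewrite -(nilQ (x * y) z t).
by rewrite lieMl lieDl !lieMl !nilQ mulr0 mul0r add0r addr0.
Qed.

(** When x and y are the two entries of one commutator this is antisymmetry; when
they sit in neighbouring commutators, [z,x][y,t] is turned into [z,y][x,t] by
two uses of [lie_swap] and one of antisymmetry. The parity condition ensures
that both x and y do occur in commutators. *)
Lemma comm_prod_swap (s1 s2 : seq Q) x y : ~~ odd (size s1 + size s2) ->
  comm_prod (s1 ++ x :: y :: s2) = - comm_prod (s1 ++ y :: x :: s2).
Proof.
elim/seq_ind2: s1 => [|z|z t s1 IH] /=.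
- by rewrite [lie y x]lieC mulNr opprK.
- case: s2 => [//|t s2] _ /=; rewrite !mulrA -mulNr; congr (_ * _).
  by rewrite lie_swap [lie y x]lieC mulrN opprK lie_swap.
by rewrite negbK => /IH->; rewrite mulrN.
Qed.

Lemma comm_prod_1 (s : seq Q) : ~~ odd (size s) -> 1 \in s -> comm_prod s = 0.
Proof.
elim/seq_ind2: s => //= x y s IH; rewrite negbK => /IH{}IH.
rewrite !inE => /or3P[/eqP<-|/eqP<-|/IH->]; last by rewrite mulr0.
  by rewrite lie1 mul0r.
by rewrite lieC lie1 oppr0 mul0r.
Qed.

End LieNilpotent.

Lemma rmorph_lie (A B : pzRingType) (f : {rmorphism A -> B}) x y :
  f (lie x y) = lie (f x) (f y).
Proof. by rewrite /lie rmorphB !rmorphM. Qed.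

Lemma rmorph_comm_prod (A B : pzRingType) (f : {rmorphism A -> B}) s :
  f (comm_prod s) = comm_prod (map f s).
Proof.
elim/seq_ind2: s => [|x|x y s IH] /=; rewrite ?rmorph1 //.
by rewrite rmorphM IH rmorph_lie.
Qed.

(** The head of s is brought from its place in t to the front by adjacent
transpositions; the prefix p lets the induction go on behind it. *)
Lemma perm_swap_ind (T : eqType) (E : seq T -> seq T -> Prop) :
  (forall s, E s s) -> (forall s t u, E s t -> E t u -> E s u) ->
  (forall p x y s, E (p ++ x :: y :: s) (p ++ y :: x :: s)) ->
  forall s t, perm_eq s t -> E s t.
Proof.
move=> Erefl Etrans Eswap s t.
suff H p: perm_eq s t -> E (p ++ s) (p ++ t) by exact: (H [::]).
elim: s t p => [|x s IH] t p st.
  by rewrite perm_sym in st; rewrite (perm_nilP st).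
have /path.splitPr tx: x \in t by rewrite -(perm_mem st) mem_head.
case: tx st => t1 t2; rewrite perm_sym perm_catC /= perm_cons perm_catC perm_sym.
move=> /(IH _ (rcons p x)); rewrite !cat_rcons => /Etrans; apply.
elim: t1 p => [//|y t1 IHt] p /=.
by apply: Etrans (Eswap _ _ _ _) _; rewrite -!(cat_rcons y); apply: IHt.
Qed.

(** * Integer combinations of polynomial functions *)

Section IntSpan.
Variables (n : nat) (C : pzRingType -> Prop).

(** A ring-valued function of n arguments, given simultaneously in all rings. Making
the ring an argument lets the coefficients of a combination be chosen once for
all rings of a class [C], without constructing a free ring of that class. *)
Definition family := forall Q : pzRingType, ('I_n -> Q) -> Q.

Definition int_span (T : finType) (b : T -> family) (F : family) :=
  exists c : T -> int,
    forall Q, C Q -> forall x, F Q x = \sum_t b t Q x *~ c t.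

Lemma int_span_eq T b F F' :
    (forall Q, C Q -> forall x, F Q x = F' Q x) ->
  @int_span T b F' -> @int_span T b F.
Proof.
by move=> FF' [c cF]; exists c => Q CQ x; rewrite FF' // cF.
Qed.

Lemma int_span_gen (T : finType) b t m :
  @int_span T b (fun Q x => b t Q x *~ m).
Proof.
exists (fun u => m *+ (u == t)) => Q _ x; rewrite (bigD1 t) //= eqxx mulr1n.
by rewrite big1 ?addr0 // => u /negPf->.
Qed.

Lemma int_spanD (T : finType) b F F' : @int_span T b F -> @int_span T b F' ->
  @int_span T b (fun Q x => F Q x + F' Q x).
Proof.
move=> [c cF] [c' cF']; exists (fun t => c t + c' t) => Q CQ x.
by rewrite cF // cF' // -big_split; apply: eq_bigr => t _; rewrite mulrzDr.
Qed.

Lemma int_spanN (T : finType) b F : @int_span T b F ->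
  @int_span T b (fun Q x => - F Q x).
Proof.
move=> [c cF]; exists (fun t => - c t) => Q CQ x.
by rewrite cF // -sumrN; apply: eq_bigr => t _; rewrite mulrNz.
Qed.

Lemma int_span_trans (T T' : finType) b b' F :
  (forall t, @int_span T' b' (b t)) -> @int_span T b F -> @int_span T' b' F.
Proof.
move=> /boolp.choice[d dP] [c cF]; exists (fun k => \sum_t d t k * c t).
move=> Q CQ x; rewrite cF //.
under eq_bigr => t _ do rewrite (dP t Q CQ) mulrz_suml.
rewrite exchange_big; apply: eq_bigr => k _.
by rewrite mulrz_sumr; apply: eq_bigr => t _; rewrite mulrzA.
Qed.

End IntSpan.

(** * Normal form of multilinear words *)

Section NormalForm.
Variable n : nat.

Definition word (w : seq 'I_n) : family n :=
  fun Q x => \prod_(i <- w) x i.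

Definition word_comm (u k : seq 'I_n) : family n :=
  fun Q x => (\prod_(i <- u) x i) * comm_prod [seq x i | i <- k].

Definition evenset := {K : {set 'I_n} | ~~ odd #|K|}.

(** The element b_K; [enum] lists both K and its complement in increasing order. *)
Definition basis (K : evenset) : family n :=
  word_comm (enum (~: val K)) (enum (val K)).

Definition perm_word (s : 'S_n) : family n :=
  fun Q x => \prod_(i < n) x (s i).

Lemma word_perm w : perm_eq w (enum 'I_n) ->
  exists s : 'S_n, forall (Q : pzRingType) (x : 'I_n -> Q),
    word w x = perm_word s x.
Proof.
move=> pw; have sz: size w == n by rewrite (perm_size pw) size_enum_ord.
have uw: uniq w by rewrite (perm_uniq pw) enum_uniq.
pose W := Tuple sz; have injW: injective (tnth W).
  by apply/tuple_uniqP.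
exists (perm injW) => Q x; rewrite /word /perm_word.
rewrite (big_tnth _ _ w) /=.
under [RHS]eq_bigr => i _ do rewrite permE.
rewrite -[LHS](big_tnth _ _ _ xpredT) -[RHS](big_tuple _ _ W xpredT x).
by [].
Qed.

(** Holds in every ring: each commutator [x,y] is expanded as xy - yx. *)
Lemma word_comm_perm_span u k : perm_eq (u ++ k) (enum 'I_n) ->
  ~~ odd (size k) -> int_span (n := n) (fun=> True) perm_word (word_comm u k).
Proof.
elim/seq_ind2: k u => [|x|x y k IH] u //=; rewrite ?negbK.
  rewrite cats0 => /word_perm[s sE] _.
  apply: int_span_eq (int_span_gen _ _ s 1) => Q _ x.
  by rewrite /word_comm /= mulr1 -sE.
move=> uk ek.
pose spanned v := int_span (n := n) (fun=> True) perm_word (word_comm v k).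
have [H1 H2] : spanned (u ++ [:: x; y]) /\ spanned (u ++ [:: y; x]).
  split; apply: IH => //; rewrite -catA //=.
  apply: perm_trans uk; rewrite perm_cat2l.
  by apply/seq.permP=> a /=; rewrite addnCA.
apply: int_span_eq (int_spanD H1 (int_spanN H2)) => Q _ a.
rewrite /word_comm /= !big_cat !big_cons !big_nil /= !mulr1 /lie mulrA.
by rewrite mulrBr mulrBl.
Qed.

Lemma comm_prod_perm (k k' : seq 'I_n) : perm_eq k k' -> ~~ odd (size k) ->
  exists m : int, forall Q, lie_nilpotent2 Q -> forall x : 'I_n -> Q,
    comm_prod [seq x i | i <- k] = comm_prod [seq x i | i <- k'] *~ m.
Proof.
move=> kk'; suff: size k' = size k /\ (~~ odd (size k) ->
  exists m : int, forall Q, lie_nilpotent2 Q -> forall x : 'I_n -> Q,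
    comm_prod [seq x i | i <- k] = comm_prod [seq x i | i <- k'] *~ m) by case.
elim/perm_swap_ind: k k' / kk' => [s|s t u [sz E] [sz' E']|p x y s].
- by split=> // _; exists 1.
- rewrite sz'; split=> // es; have [m mE] := E es.
  rewrite -sz in es; have [m' mE'] := E' es; exists (m' * m) => Q nQ x.
  by rewrite mE // mE' // mulrzA.
split; first by rewrite !size_cat.
rewrite size_cat /= !addnS /= negbK => es; exists (-1) => Q nQ a.
by rewrite !map_cat /= comm_prod_swap ?size_map // mulrN1z.
Qed.

(** Induction on the length of u. Exchanging two neighbours a, b of u produces the
error term with a, b removed from u and the central factor [a,b] put in front of
the commutators, which is covered by the induction hypothesis; so u may be
sorted. The entries of k may then be sorted up to sign. *)
Lemma word_comm_basis_span u k : perm_eq (u ++ k) (enum 'I_n) ->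
  ~~ odd (size k) -> int_span lie_nilpotent2 basis (word_comm u k).
Proof.
have [m] := ubnP (size u); elim: m => // m IH in u k *.
rewrite ltnS => um uk ek.
have uuk : uniq (u ++ k) by rewrite (perm_uniq uk) enum_uniq.
have [uu uk0 ukk] := (and3P (eq_ind _ is_true uuk _ (cat_uniq _ _))).
pose K := [set i in k].
have pk : perm_eq k (enum K).
  by apply: uniq_perm; rewrite ?enum_uniq // => i; rewrite mem_enum inE.
have pu : perm_eq u (enum (~: K)).
  apply: uniq_perm; rewrite ?enum_uniq // => i; rewrite mem_enum !inE.
  have := perm_mem uk i; rewrite mem_cat mem_enum inE => /orP[iu|ik].
    by rewrite iu; apply/esym; apply: contra uk0 => ik; apply/hasP; exists i.
  by rewrite ik; apply/negbTE; apply: contra uk0 => iu; apply/hasP; exists i.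
have eK : ~~ odd #|K| by rewrite cardE -(perm_size pk).
(* the sorted case, where only the commutators remain to be reordered *)
have HK : int_span lie_nilpotent2 basis (word_comm (enum (~: K)) k).
  have [c cE] := comm_prod_perm pk ek.
  apply: int_span_eq (int_span_gen _ _ (exist _ K eK : evenset) c) => Q nQ x.
  by rewrite /word_comm cE // mulrzAr.
suff: perm_eq u (enum (~: K)) /\ (perm_eq (u ++ k) (enum 'I_n) ->
    (size u <= m)%N ->
    int_span lie_nilpotent2 basis (word_comm (enum (~: K)) k) ->
    int_span lie_nilpotent2 basis (word_comm u k)) by case=> _; apply.
elim/perm_swap_ind: u _ / pu {um uk uuk uu uk0 HK} =>
   [s|s t v [st E] [tv E']|p x y s]; first by split.
  split=> [|sk sm Hv]; first exact: perm_trans tv.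
  apply: E => //; apply: E' => //; last by rewrite -(perm_size st).
  by apply: perm_trans sk; rewrite perm_cat2r perm_sym.
split; first by rewrite perm_cat2l; apply/seq.permP=> a /=; rewrite addnCA.
move=> pk' sm H.
(* the error term of the exchange of x and y *)
have H' : int_span lie_nilpotent2 basis (word_comm (p ++ s) (x :: y :: k)).
  apply: IH; rewrite /= ?negbK //.
    by move: sm; rewrite !size_cat /= !addnS => /ltnW.
  apply: perm_trans pk'; rewrite -!catA perm_cat2l /=.
  by rewrite -[s ++ _]/(s ++ [:: x; y] ++ k) perm_catCA.
apply: int_span_eq (int_spanD H H') => Q nQ a.
rewrite /word_comm /= !big_cat !big_cons /=.
set A := \prod_(i <- p) _; set B := \prod_(i <- s) _; set D := comm_prod _.
have -> : A * B * (lie (a x) (a y) * D) = A * (lie (a x) (a y) * B) * D.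
  by rewrite (lie_eq0 (nQ (a x) (a y) B)) !mulrA.
rewrite -mulrDl -mulrDr; congr (_ * _ * _).
by rewrite /lie mulrBl !mulrA addrC subrK.
Qed.

Lemma perm_word_basis_span s :
  int_span lie_nilpotent2 basis (perm_word s).
Proof.
have : int_span lie_nilpotent2 basis (word_comm [seq s i | i <- enum 'I_n] [::]).
  apply: word_comm_basis_span => //; rewrite cats0.
  apply: uniq_perm; rewrite ?(map_inj_uniq perm_inj) ?enum_uniq //.
  move=> i; rewrite [in RHS]mem_enum; apply/mapP; exists ((s^-1)%g i).
    by rewrite mem_enum.
  by rewrite permKV.
apply: int_span_eq => Q _ x.
rewrite /word_comm /= mulr1 big_map /perm_word.
by rewrite enumT [index_enum _]unlock.
Qed.

End NormalForm.

(** * Commutators in the Grassmann algebra *)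

Section GrassmannParity.
Variable R : comPzRingType.
Local Notation G := (grassmann R).

(** The homogeneous components of the Z/2-grading ([true] for odd). They are generated
by the rules that the grading obeys; 0 belongs to both. *)
Inductive parity : bool -> G -> Prop :=
  | parity_gen i : parity true (ggen R i)
  | parity_0 b : parity b 0
  | parity_1 : parity false 1
  | parity_opp b x : parity b x -> parity b (- x)
  | parity_add b x y : parity b x -> parity b y -> parity b (x + y)
  | parity_mul b c x y : parity b x -> parity c y -> parity (b (+) c) (x * y)
  | parity_scale b (a : R) x : parity b x -> parity b (a *: x).

Lemma gscalerAl (a : R) (x y : G) : a *: (x * y) = (a *: x) * y.
Proof. exact: gscaleAl. Qed.

Lemma gscalerAr (a : R) (x y : G) : a *: (x * y) = x * (a *: y).
Proof. exact: gscaleAr. Qed.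

Definition sgn_comm (b : bool) (x y : G) := x * y = (-1) ^+ b * (y * x).

Lemma sgn_commC b x y : sgn_comm b x y -> sgn_comm b y x.
Proof. by rewrite /sgn_comm => ->; rewrite signrMK. Qed.

(** The elements x that commute with a fixed y up to the sign f(parity of x) obey the
rules generating [parity], provided that f is additive. It is used for f = id,
with y a generator, and for f = (&& c), with y of parity c. *)
Lemma parity_sgn_comml (f : bool -> bool) y :
    (forall i, sgn_comm (f true) (ggen R i) y) -> f false = false ->
    (forall b c, f (b (+) c) = f b (+) f c) ->
  forall b x, parity b x -> sgn_comm (f b) x y.
Proof.
move=> fgen f0 fD b x; elim=> {b x} [i|b||b x _|b x z _ + _|b c x z _ + _|b a x _];
  rewrite /sgn_comm.
- exact: fgen.
- by rewrite mul0r !mulr0.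
- by rewrite f0 !mul1r mulr1.
- by move=> E; rewrite mulNr E !mulrN.
- by move=> E E'; rewrite mulrDl E E' -mulrDr -mulrDr.
- move=> E E'; rewrite -mulrA E' [x * (_ * _)]mulrA (commr_sign x (f c)).
  rewrite fD addbC signr_addb -!mulrA.
  by rewrite [x * (y * z)]mulrA E -!mulrA.
by move=> E; rewrite -gscalerAl E -gscalerAr -gscalerAr.
Qed.

Lemma parity_comm b c x y : parity b x -> parity c y -> sgn_comm (b && c) x y.
Proof.
move=> px py; apply: (@parity_sgn_comml (andb^~ c)) px => // [i|b' c'].
  apply/sgn_commC; apply: (@parity_sgn_comml (andb true)) py => // j.
  by rewrite /sgn_comm mulN1r; apply: ggen_anticomm.
exact: andb_addl.
Qed.

Lemma parity_decomp (x : G) :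
  exists x0 x1, [/\ parity false x0, parity true x1 & x = x0 + x1].
Proof.
rewrite -(gpi_repr x); elim: (repr x) => {x} [i||t IH|t IHt u IHu||t IHt u IHu|a t IH].
- by exists 0, (ggen R i); rewrite add0r; split=> //; constructor.
- by exists 0, 0; rewrite addr0; split=> //; constructor.
- have [x0 [x1 [p0 p1 E]]] := IH; exists (- x0), (- x1).
  by split; try (by constructor); rewrite -gpi_opp E -opprD.
- have [x0 [x1 [p0 p1 E]]] := IHt; have [y0 [y1 [q0 q1 F]]] := IHu.
  exists (x0 + y0), (x1 + y1).
  by split; try (by constructor); rewrite -gpi_add E F addrACA.
- by exists 1, 0; rewrite addr0; split=> //; constructor.
- have [x0 [x1 [p0 p1 E]]] := IHt; have [y0 [y1 [q0 q1 F]]] := IHu.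
  exists (x0 * y0 + x1 * y1), (x0 * y1 + x1 * y0); split.
  + by apply: parity_add; [apply: (parity_mul p0 q0)|apply: (parity_mul p1 q1)].
  + by apply: parity_add; [apply: (parity_mul p0 q1)|apply: (parity_mul p1 q0)].
  rewrite -gpi_mul E F -[gmul _ _]/((x0 + x1) * (y0 + y1)) mulrDl !mulrDr.
  by rewrite -!addrA; congr (_ + _); rewrite [RHS]addrC -!addrA;
    congr (_ + _); rewrite addrC.
- have [x0 [x1 [p0 p1 E]]] := IH; exists (a *: x0), (a *: x1).
  by split; try (by constructor); rewrite -gpi_scale E -scalerDr.
Qed.

Lemma even_lie (x y : G) : parity false x -> lie x y = 0.
Proof.
move=> px; have [y0 [y1 [p0 p1 ->]]] := parity_decomp y.
rewrite /lie mulrDl mulrDr (parity_comm px p0) (parity_comm px p1) /=.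
by rewrite !mul1r subrr.
Qed.

(** Only the odd parts of x and y contribute to [x,y], which is then even. *)
Lemma grassmann_nilpotent : lie_nilpotent2 G.
Proof.
move=> x y z; have [x0 [x1 [px0 px1 ->]]] := parity_decomp x.
have [y0 [y1 [py0 py1 ->]]] := parity_decomp y.
rewrite [lie (x0 + x1) _]lieDl (even_lie _ px0) add0r [lie x1 _]lieDr.
rewrite [lie x1 y0]lieC (even_lie _ py0) oppr0 add0r.
apply: even_lie; apply: parity_add; first exact: (parity_mul px1 py1).
by apply: parity_opp; apply: (parity_mul py1 px1).
Qed.

End GrassmannParity.

(** * Linear independence of the monomials in distinct generators *)

Section GrassmannModel.
Variable R : comPzRingType.
Local Notation G := (grassmann R).
Implicit Types (S : nat -> bool) (f : (nat -> bool) -> R).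

(** The Grassmann algebra acts on the functions f from sets of indices to R: e_i
sends f to the function S |-> 0 if i is in S, and (-1)^s f(S + i) otherwise, where
s is the number of elements of S below i. Working with operators makes the
associativity of the product immediate, and with functions on sets rather than
formal sums avoids any finiteness condition. *)
Definition sgn_below i S := \big[addb/false]_(j < i) S j.
Definition insert i S j := (j == i) || S j.

Fixpoint act (t : gterm R) f S : R :=
  match t with
  | GGen i => if S i then 0 else (-1) ^+ sgn_below i S * f (insert i S)
  | GZero => 0
  | GOpp t => - act t f S
  | GAdd t u => act t f S + act u f S
  | GOne => f S
  | GMul t u => act t (act u f) S
  | GScale a t => a * act t f S
  end.

Lemma act_ext t f f' S : f =1 f' -> act t f S = act t f' S.
Proof. by move=> /funext->. Qed.

Lemma act_linear t a f f' S :
  act t (fun S => a * f S + f' S) S = a * act t f S + act t f' S.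
Proof.
elim: t f f' S => [i||t IH|t IHt u IHu||t IHt u IHu|b t IH] f f' S //=.
- by case: ifP; rewrite ?mulr0 ?addr0 // mulrDr mulrCA.
- by rewrite mulr0 addr0.
- by rewrite IH opprD mulrN.
- by rewrite IHt IHu mulrDr addrACA.
- by rewrite -IHt; apply: act_ext => S'; apply: IHu.
- by rewrite IH mulrDr mulrCA.
Qed.

(** The only source of signs: inserting i changes the sign of e_j exactly when
i < j, so that one of e_i e_j and e_j e_i picks up an extra sign. *)
Lemma sgn_below_insert i j S : ~~ S i ->
  sgn_below j (insert i S) = (i < j)%N (+) sgn_below j S.
Proof.
move=> Si; rewrite /sgn_below /insert.
have -> : (i < j)%N = \big[addb/false]_(k < j) (k == i :> nat).
  elim: j => [|j IH]; first by rewrite big_ord0.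
  by rewrite big_ord_recr /= -IH ltnS; case: ltngtP.
rewrite -big_split; apply: eq_bigr => k _ /=.
by case: eqP => //= ->; rewrite (negPf Si).
Qed.

Lemma act_anticomm i j f S :
  act (GGen i) (act (GGen j) f) S = - act (GGen j) (act (GGen i) f) S.
Proof.
have insE a b S' : insert a S' b = (b == a) || S' b by [].
rewrite /= !insE; have [->|ij] := eqVneq i j.
  by rewrite /= mulr0 if_same oppr0.
rewrite /=.
case Si: (S i); case Sj: (S j); rewrite ?mulr0 ?oppr0 //.
rewrite !sgn_below_insert ?Si ?Sj //.
have -> : insert i (insert j S) = insert j (insert i S).
  by apply/funext=> k; rewrite /insert orbCA.
rewrite !mulrA -mulNr -!signr_addb; congr (_ * _).
by move: ij; case: ltngtP => //= _ _; case: (sgn_below i S); case: (sgn_below j S);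
  rewrite /= ?expr1 ?opprK.
Qed.

(** All the relations hold by computation on functions except those where an operator
is applied to a sum or a multiple, which hold by [act_linear]. *)
Lemma act_gcong t u : gcong t u -> forall f S, act t f S = act u f S.
Proof.
have lin0 v S : act v (fun=> 0) S = 0.
  have := act_linear v 1 (fun=> 0) (fun=> 0) S; rewrite !mul1r addr0 => E.
  by apply: (addrI (act v (fun=> 0) S)); rewrite addr0 -E.
have linD v f f' S : act v (fun S => f S + f' S) S = act v f S + act v f' S.
  rewrite -[act v f S]mul1r -act_linear; apply: act_ext => S'.
  by rewrite mul1r.
have linZ v a f S : act v (fun S => a * f S) S = a * act v f S.
  rewrite -[RHS]addr0 -(lin0 v S) -act_linear; apply: act_ext => S'.
  by rewrite addr0.
elim=> {t u} /=.
- by [].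
- by move=> t u _ IH f S; rewrite IH.
- by move=> t u v _ IH _ IH' f S; rewrite IH IH'.
- by move=> t t' _ IH f S; rewrite IH.
- by move=> t t' u u' _ IH _ IH' f S; rewrite IH IH'.
- by move=> t t' u u' _ IH _ IH' f S; rewrite IH; apply: act_ext.
- by move=> a t t' _ IH f S; rewrite IH.
- by move=> t u v f S; rewrite addrA.
- by move=> t u f S; rewrite addrC.
- by move=> t f S; rewrite add0r.
- by move=> t f S; rewrite addNr.
- by [].
- by [].
- by [].
- by [].
- by move=> t u v f S; rewrite linD.
- by move=> a b t f S; rewrite mulrA.
- by move=> t f S; rewrite mul1r.
- by move=> a t u f S; rewrite mulrDr.
- by move=> a b t f S; rewrite mulrDl.
- by [].
- by move=> a t u f S; rewrite linZ.
by move=> i j f S; apply: act_anticomm.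
Qed.

Definition gact (x : G) := act (repr x).

Lemma gactE t f S : gact (gpi t) f S = act t f S.
Proof. by rewrite /gact; apply: act_gcong; apply: gcong_repr. Qed.

Lemma gact0 f S : gact 0 f S = 0.
Proof. exact: (gactE GZero). Qed.

Lemma gact_scale (a : R) (x : G) f S : gact (a *: x) f S = a * gact x f S.
Proof. exact: (gactE (GScale a (repr x))). Qed.

Lemma gactM (x y : G) f S : gact (x * y) f S = gact x (gact y f) S.
Proof. exact: (gactE (GMul (repr x) (repr y))). Qed.

Lemma gact_gen i f S : gact (ggen R i) f S = act (GGen i) f S.
Proof. exact: gactE. Qed.

(** Each e_i enlarges the set at which the function is evaluated, so that no factor
vanishes as long as the indices are distinct and outside S; on the constant
function 1 only the signs remain. *)
Lemma gact_prod_gen (s : seq nat) S : uniq s -> (forall i, i \in s -> ~~ S i) ->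
  exists b : bool, gact (\prod_(i <- s) ggen R i) (fun=> 1) S = (-1) ^+ b.
Proof.
elim: s S => [|i s IH] S /=.
  by rewrite big_nil => _ _; exists false; apply: (gactE GOne).
case/andP=> si us Ss; have [j sj|b bE] := IH (insert i S) us.
  rewrite /insert negb_or (Ss j) ?inE ?sj ?orbT // andbT.
  by apply: contraNneq si => <-.
exists (sgn_below i S (+) b); rewrite big_cons.
rewrite gactM gact_gen /= (negPf (Ss i _)) ?mem_head //.
by rewrite signr_addb -bE.
Qed.

Lemma prod_gen_free (s : seq nat) (m : int) : uniq s ->
  (\prod_(i <- s) ggen R i) *~ m = 0 -> m%:~R = 0 :> R.
Proof.
move=> us; rewrite -scaler_int => m0.
have [//|b bE] := @gact_prod_gen s (fun=> false) us.
have := gact_scale m%:~R (\prod_(i <- s) ggen R i) (fun=> 1) (fun=> false).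
rewrite m0 gact0 bE => /esym E.
by rewrite -[LHS](signrMK b) [_ * m%:~R]mulrC E mulr0.
Qed.

End GrassmannModel.

(** * Evaluation and substitution of polynomials *)

Section Evaluation.
Variables (A : pzRingType) (a : nat -> A).

Definition ev (g : ZX1) : A :=
  \sum_(w <- msupp g) (\prod_(i <- (w : seq nat)) a i) *~ g@_w.

Lemma evEw (d : {fset {fmonom nat}}) g : (msupp g `<=` d)%fset ->
  ev g = \sum_(w <- d) (\prod_(i <- (w : seq nat)) a i) *~ g@_w.
Proof.
move=> le; rewrite [LHS](big_fset_incl _ le) => //= w _ /mcoeff_outdom->.
by rewrite mulr0z.
Qed.

Lemma evU c w : ev << c *g w >> = (\prod_(i <- (w : seq nat)) a i) *~ c.
Proof. by rewrite (evEw msuppU_le) big_seq_fset1 mcoeffUU. Qed.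

Lemma ev_zmod_morphism : zmod_morphism ev.
Proof.
move=> g h; pose d := (msupp g `|` msupp h)%fset.
rewrite (@evEw d (g - h)) ?msuppB_le // (@evEw d g) ?fsubsetUl //.
rewrite (@evEw d h) ?fsubsetUr // -sumrB; apply: eq_bigr => w _.
by rewrite mcoeffB mulrzBr.
Qed.

HB.instance Definition _ := GRing.isZmodMorphism.Build ZX1 A ev ev_zmod_morphism.

Lemma ev_monoid_morphism : monoid_morphism ev.
Proof.
split=> [|g h]; first by rewrite evU fm1 big_nil.
rewrite malgME raddf_sum /= [ev g]/ev mulr_suml /=; apply: eq_bigr => v _.
rewrite raddf_sum /= [ev h]/ev mulr_sumr /=; apply: eq_bigr => w _.
by rewrite evU fmM big_cat mulrzAr mulrzAl -mulrzA mulrC.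
Qed.

HB.instance Definition _ := GRing.isMonoidMorphism.Build ZX1 A ev ev_monoid_morphism.

Lemma ev_var i : ev (zx_var i) = a i.
Proof. by rewrite evU fmU big_seq1. Qed.

Lemma zx_evalE (f : ZX) : zx_eval a f = ev (zx_val f).
Proof. by []. Qed.

End Evaluation.

Section Substitution.
Variable a : nat -> ZX.

Lemma ev_noconst (f : ZX) : ev (fun i => zx_val (a i)) (zx_val f) \in noconst.
Proof.
rewrite /ev big_seq; apply: rpred_sum => w wf; apply: rpredMz.
have: w != mone.
  by apply: contraTneq wf => ->; rewrite -mcoeff_neq0 negbK; apply: zx_valP.
rewrite -fdeg_eq0 fdegE; case: (w : seq nat) => // i s _.
by rewrite big_cons noconstM ?zx_valP.
Qed.

Definition subst (f : ZX) : ZX := MkZX (ev_noconst f).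

Lemma subst_zmod_morphism : zmod_morphism subst.
Proof. by move=> f g; apply: val_inj; rewrite [RHS]zx_valB /= -rmorphB -zx_valB. Qed.

HB.instance Definition _ :=
  GRing.isZmodMorphism.Build ZX ZX subst subst_zmod_morphism.

Lemma substM : {morph subst : f g / zx_mul f g}.
Proof. by move=> f g; apply: val_inj; rewrite /= rmorphM. Qed.

Lemma subst_var i : subst (zx_var i) = a i.
Proof. by apply: val_inj; rewrite /= ev_var. Qed.

Lemma subst_comm f g : subst (zx_comm f g) = zx_comm (subst f) (subst g).
Proof. by rewrite /zx_comm raddfB /= !substM. Qed.

End Substitution.

(** * Quotients by T-ideals *)

Section ZmodQuotient.
Local Open Scope quotient_scope.
Variables (A : zmodType) (I : zmodClosed A).

Definition quot_pi (x : A) : Quotient.quot I := \pi_(Quotient.quot I) x.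

Lemma quot_pi_zmod_morphism : zmod_morphism quot_pi.
Proof.
have piD x y : quot_pi (x + y) = quot_pi x + quot_pi y by apply: Quotient.pi_add.
by move=> x y; apply: (addIr (quot_pi y)); rewrite -piD !subrK.
Qed.

HB.instance Definition _ :=
  GRing.isZmodMorphism.Build A (Quotient.quot I) quot_pi quot_pi_zmod_morphism.

Lemma quot_pi_eq x y : quot_pi x = quot_pi y <-> x - y \in I.
Proof. by rewrite Quotient.idealrBE; split=> [/eqP|/eqP]. Qed.

Lemma quot_pi_eq0 x : quot_pi x = 0 <-> x \in I.
Proof. by rewrite -(raddf0 quot_pi) quot_pi_eq subr0. Qed.

Lemma quot_piK (q : Quotient.quot I) : quot_pi (repr q) = q.
Proof. exact: reprK. Qed.

Lemma quot_ind (p : Quotient.quot I -> Prop) :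
  (forall x, p (quot_pi x)) -> forall q, p q.
Proof. by move=> H q; rewrite -[q]quot_piK; apply: H. Qed.

End ZmodQuotient.

Section RingQuotient.
Variables (A : pzRingType) (I : zmodClosed A).
Hypothesis Iml : forall x y : A, y \in I -> x * y \in I.
Hypothesis Imr : forall x y : A, x \in I -> x * y \in I.

Definition ring_quot := Quotient.quot I.
HB.instance Definition _ := GRing.Zmodule.on ring_quot.

Local Notation Q := ring_quot.
Definition ring_pi : A -> Q := @quot_pi A I.
HB.instance Definition _ := GRing.Additive.on ring_pi.
Local Notation pi := ring_pi.

Let piD x y : pi (x + y) = pi x + pi y.
Proof. exact: raddfD. Qed.

Let mulq (p q : Q) : Q :=
  pi (repr (p : Quotient.quot I) * repr (q : Quotient.quot I)).

Let piM x y : mulq (pi x) (pi y) = pi (x * y).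
Proof.
apply/quot_pi_eq; set x' := repr _; set y' := repr _.
have Ix : x' - x \in I by apply/quot_pi_eq; rewrite quot_piK.
have Iy : y' - y \in I by apply/quot_pi_eq; rewrite quot_piK.
rewrite -(subrK (x' * y) (x' * y')) -mulrBr -addrA -mulrBl.
by apply: rpredD; [apply: Iml|apply: Imr].
Qed.

Let pi_ind (p : Q -> Prop) : (forall x, p (pi x)) -> forall q, p q.
Proof. exact: quot_ind. Qed.

Let mulqA : associative mulq.
Proof.
by elim/pi_ind=> x; elim/pi_ind=> y; elim/pi_ind=> z; rewrite !piM mulrA.
Qed.
Let mul1q : left_id (pi 1) mulq.
Proof. by elim/pi_ind=> x; rewrite piM mul1r. Qed.
Let mulq1 : right_id (pi 1) mulq.
Proof. by elim/pi_ind=> x; rewrite piM mulr1. Qed.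
Let mulqDl : left_distributive mulq +%R.
Proof.
by elim/pi_ind=> x; elim/pi_ind=> y; elim/pi_ind=> z; rewrite -piD !piM -piD mulrDl.
Qed.
Let mulqDr : right_distributive mulq +%R.
Proof.
by elim/pi_ind=> x; elim/pi_ind=> y; elim/pi_ind=> z; rewrite -piD !piM -piD mulrDr.
Qed.

HB.instance Definition _ :=
  GRing.Zmodule_isPzRing.Build Q mulqA mul1q mulq1 mulqDl mulqDr.

Let pi_monoid : monoid_morphism pi.
Proof. by split=> // x y; rewrite -piM. Qed.
HB.instance Definition _ := GRing.isMonoidMorphism.Build A Q pi pi_monoid.

(** Surjectivity and the kernel are all that the sequel needs of the quotient ring. *)
Lemma ring_quotient_exists : exists (B : pzRingType) (f : {rmorphism A -> B}),
  (forall y, exists x, f x = y) /\ (forall x, f x = 0 <-> x \in I).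
Proof.
exists Q, pi; split=> [q|x]; first by elim/pi_ind: q => x; exists x.
exact: quot_pi_eq0.
Qed.

End RingQuotient.

Lemma zx_val_comm (f g : ZX) : zx_val (zx_comm f g) = lie (zx_val f) (zx_val g).
Proof. by rewrite /zx_comm zx_valB. Qed.

Lemma zx_valMn (f : ZX) k : zx_val (f *+ k) = zx_val f *+ k.
Proof. exact: (raddfMn (val : ZX -> ZX1)). Qed.

Section TidealQuotient.
Variable I : ZX -> Prop.
Hypothesis TI : is_Tideal I.

(** A T-ideal lives in the ring without unit Z<X>; seen in the ring with unit obtained
by adjoining the constants, it is still a two-sided ideal, which allows one to
form a quotient ring with unit. *)
Definition unital_ideal : {pred ZX1} :=
  fun g => `[< exists2 f, zx_val f = g & I f >].

Lemma unital_idealP (f : ZX) : reflect (I f) (zx_val f \in unital_ideal).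
Proof.
apply: (iffP (asboolP _)) => [[f' /val_inj-> //]|If]; by exists f.
Qed.

Lemma unital_ideal_zmod_closed : zmod_closed unital_ideal.
Proof.
split=> [|g h /asboolP[f <- If] /asboolP[f' <- If']].
  exact/(unital_idealP 0)/(Tideal_zero TI).
by rewrite -zx_valB; apply/unital_idealP/(Tideal_sub TI).
Qed.

HB.instance Definition _ :=
  GRing.isZmodClosed.Build ZX1 unital_ideal unital_ideal_zmod_closed.

Lemma ZX1_decomp (g : ZX1) : exists (m : int) (f : ZX), g = m%:~R + zx_val f.
Proof.
have gP : g - (g@_(mone : {fmonom nat}))%:~R \in noconst.
  rewrite unfold_in mcoeffB -[X in _ - X]/(_@_mone).
  by rewrite (rmorph_int (mcoeff mone)) intz subrr.
by exists (g@_(mone : {fmonom nat})), (MkZX gP); rewrite addrC subrK.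
Qed.

Lemma unital_ideal_mull (g h : ZX1) : h \in unital_ideal -> g * h \in unital_ideal.
Proof.
move=> Ih; have [m [f ->]] := ZX1_decomp g; rewrite mulrDl mulrzl.
rewrite rpredD ?rpredMz //; case/asboolP: Ih => f' <- If'.
exact/(unital_idealP (zx_mul f f'))/(Tideal_mull TI).
Qed.

Lemma unital_ideal_mulr (g h : ZX1) : g \in unital_ideal -> g * h \in unital_ideal.
Proof.
move=> Ig; have [m [f ->]] := ZX1_decomp h; rewrite mulrDr mulrzr.
rewrite rpredD ?rpredMz //; case/asboolP: Ig => f' <- If'.
exact/(unital_idealP (zx_mul f' f))/(Tideal_mulr TI).
Qed.

(** Substituting for the three variables shows that all triple commutators of
elements without constant term lie in I; constants are central, so that adding
them does not change a commutator. *)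
Lemma Tideal_quotient :
    I (zx_comm (zx_comm (zx_var 0) (zx_var 1)) (zx_var 2)) ->
  exists (Q : pzRingType) (pi : {rmorphism ZX1 -> Q}),
    lie_nilpotent2 Q /\ forall f : ZX, pi (zx_val f) = 0 <-> I f.
Proof.
move=> Ixyz.
have [Q [pi [pi_surj pi0]]] :=
  ring_quotient_exists unital_ideal_mull unital_ideal_mulr.
exists Q, pi; split; last by move=> f; rewrite pi0; split=> /unital_idealP.
move=> x y z; have [gx <-] := pi_surj x; have [gy <-] := pi_surj y.
have [gz <-] := pi_surj z; rewrite -!rmorph_lie; apply/pi0.
have [mx [u ->]] := ZX1_decomp gx; have [my [v ->]] := ZX1_decomp gy.
have [mz [w ->]] := ZX1_decomp gz.
rewrite [lie (_ + _) (_ + zx_val v)]lieDl lie_intl add0r.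
rewrite [lie _ (_ + zx_val v)]lieDr [lie _ my%:~R]lieC lie_intl oppr0 add0r.
rewrite [lie _ (_ + _)]lieDr [lie _ mz%:~R]lieC lie_intl oppr0 add0r.
rewrite -!zx_val_comm; apply/unital_idealP.
pose a i := if i is j.+1 then if j is 0 then v else w else u.
have := Tideal_endo TI (substM a) Ixyz.
by rewrite /= !subst_comm !subst_var.
Qed.

End TidealQuotient.

(** * Divisibility, counting and the group Z/l *)

Lemma int_proj_Zmod (l : nat) : exists proj : {additive int -> Zmod l},
  (forall z, exists c, proj c = z) /\
  (forall c, proj c = 0 <-> (l%:Z %| c)%Z).
Proof.
case: l => [|m].
  exists idfun; split=> [z|c]; first by exists z.
  by rewrite dvd0z; split=> /eqP.
pose u : 'I_m.+1 := inZp 1; pose f (c : int) : Zmod m.+1 := u *~ c.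
have fB : zmod_morphism f by move=> c d; rewrite /f mulrzBr.
pose fM := GRing.isZmodMorphism.Build _ _ f fB.
pose F : {additive int -> Zmod m.+1} := HB.pack f fM.
have un k : u *+ k = inZp k.
  by rewrite Zp_mulrn; apply: val_inj; rewrite /= modnMml mul1n.
have un0 k : u *+ k = 0 <-> (m.+1 %| k)%N.
  rewrite un; split=> [[/eqP //]|k0]; by apply: val_inj => /=; apply/eqP.
exists F; split=> [z|c] /=.
  by exists (nat_of_ord z)%:Z; rewrite /f -pmulrn un valZpK.
rewrite dvdzE /f; case: c => k /=; first exact: un0.
rewrite NegzE mulrNz -pmulrn -un0; split=> [/eqP|->]; rewrite ?oppr0 //.
by rewrite oppr_eq0 => /eqP.
Qed.

Lemma has_char_dvd (R : pzRingType) l : has_char R l ->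
  forall c : int, c%:~R = 0 :> R <-> (l%:Z %| c)%Z.
Proof.
move=> char_l c; suff H n : n%:R = 0 :> R <-> (l %| n)%N.
  rewrite dvdzE; case: c => n /=; first exact: H.
  rewrite NegzE mulrNz -H; split=> [/eqP|]; first by rewrite oppr_eq0 => /eqP.
  by rewrite -pmulrn => ->; rewrite oppr0.
case: char_l => [[l0 l1 lmin]|[-> nz]]; last first.
  rewrite dvd0n; split=> [|/eqP->//].
  by case: n => // n /(nz n.+1 isT).
have E : n%:R = (n %% l)%:R :> R.
  by rewrite {1}(divn_eq n l) natrD natrM l1 mulr0 add0r.
rewrite E; split=> [n0|/eqP->//]; rewrite /dvdn.
by have [//|r0] := posnP (n %% l)%N; case: (lmin (n %% l)%N); rewrite ?r0 ?ltn_mod.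
Qed.

Lemma odd_dvd_pow2 l k (c : int) : odd l \/ l = 0%N ->
  (l%:Z %| c *+ 2 ^ k)%Z -> (l%:Z %| c)%Z.
Proof.
rewrite -mulr_natr !dvdzE abszM natz /= => -[ol|->].
  by rewrite mulnC Gauss_dvdr // coprimeXr // coprimen2.
by rewrite !dvd0n muln_eq0 expn_eq0 orbF.
Qed.

(** Adding or removing the index 0 exchanges the sets of even and of odd size, so
half of the 2^n sets are even. *)
Lemma card_evenset n : (0 < n)%N -> #|{: evenset n}| = (2 ^ (n - 1))%N.
Proof.
case: n => // m _; rewrite subn1 /= card_sig.
pose E := [set K : {set 'I_m.+1} | ~~ odd #|K|].
pose f (K : {set 'I_m.+1}) := if ord0 \in K then K :\ ord0 else ord0 |: K.
have fK : involutive f.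
  move=> K; rewrite /f; have [K0|K0] := boolP (ord0 \in K).
    by rewrite setD11 setD1K.
  by rewrite setU11 setU1K.
have fodd K : odd #|f K| = ~~ odd #|K|.
  rewrite /f; case: ifP => K0; last by rewrite cardsU1 K0.
  by rewrite (cardsD1 ord0 K) K0 /= negbK.
have EC : f @: E = ~: E.
  apply/setP=> K; rewrite -{1}(fK K) mem_imset; last exact: inv_inj.
  by rewrite !inE fodd.
have := cardsC E; rewrite -EC card_imset; last exact: inv_inj.
rewrite addnn -cardsT -powersetT card_powerset cardsT card_ord.
rewrite expnS mul2n => /double_inj <-.
by apply: eq_card => K; rewrite ?inE.
Qed.

(** If b spans M over the integers and its relations are exactly the coefficient
vectors killed by [proj], then taking coefficients modulo the kernel of [proj]
is well defined and bijective. *)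
Lemma span_iso (M Z : zmodType) (T : finType) (N : nat) (b : T -> M)
    (proj : {additive int -> Z}) : #|T| = N ->
    (forall z, exists c, proj c = z) ->
    (forall q, exists c : T -> int, q = \sum_t b t *~ c t) ->
    (forall c : T -> int, \sum_t b t *~ c t = 0 <-> forall t, proj (c t) = 0) ->
  exists phi : {additive M -> {ffun 'I_N -> Z}}, bijective phi.
Proof.
case: N / => /boolp.choice[s sK] /boolp.choice[d dK] free.
have projP (c c' : T -> int) : \sum_t b t *~ c t = \sum_t b t *~ c' t <->
    forall t, proj (c t) = proj (c' t).
  have := free (fun t => c t - c' t).
  under eq_bigr => t _ do rewrite mulrzBr.
  rewrite sumrB => H; split=> [E t|E].
    by apply: subr0_eq; rewrite -raddfB; apply: H.1; rewrite E subrr.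
  by apply: subr0_eq; apply: H.2 => t; rewrite raddfB E subrr.
pose f q := [ffun i : 'I_#|T| => proj (d q (enum_val i))].
have fB : zmod_morphism f.
  move=> p q; apply/ffunP=> i; rewrite !ffunE -raddfB.
  apply: (projP (d (p - q)) (fun t => d p t - d q t)).1.
  by rewrite -dK; under eq_bigr => t _ do rewrite mulrzBr; rewrite sumrB -!dK.
pose fM := GRing.isZmodMorphism.Build _ _ f fB.
pose F : {additive M -> {ffun 'I_#|T| -> Z}} := HB.pack f fM.
pose g (h : {ffun 'I_#|T| -> Z}) := \sum_t b t *~ s (h (enum_rank t)).
exists F; exists g => [q|h] /=.
  rewrite [RHS]dK; apply/projP => t.
  by rewrite sK ffunE enum_rankK.
apply/ffunP=> i; rewrite ffunE -[RHS]sK -[in RHS](enum_valK i).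
by apply: (projP _ (fun t => s (h (enum_rank t)))).1; rewrite -dK.
Qed.

(** * Independence of the basis modulo the identities *)

Section Independence.
Variables (R : comPzRingType) (l : nat).
Hypothesis char_l : has_char R l.
Local Notation G := (grassmann R).

Lemma grassmann_ann (y : G) (c : int) : (l%:Z %| c)%Z -> y *~ c = 0.
Proof. by move=> /(has_char_dvd char_l) c0; rewrite -scaler_int c0 scale0r. Qed.

Lemma comm_prod_gen (s : seq nat) : ~~ odd (size s) ->
  comm_prod [seq ggen R i | i <- s] =
  (\prod_(i <- s) ggen R i) *+ 2 ^ (size s)./2.
Proof.
elim/seq_ind2: s => [|i|i j s IH] //=; first by rewrite big_nil mulr1n.
rewrite negbK => /IH->; rewrite !big_cons /lie.
rewrite [ggen R j * ggen R i]ggen_anticomm opprK.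
by rewrite -mulr2n mulrnAl mulrnAr -mulrnA expnS mulnC mulrA.
Qed.

Variable n : nat.

Definition test_point (J : {set 'I_n}) (i : 'I_n) : G :=
  if i \in J then ggen R i else 1.

Lemma basis_test_point (J : evenset n) : basis J (test_point (val J)) =
  (\prod_(i <- [seq val i | i <- enum (val J)]) ggen R i) *+ 2 ^ (#|val J|)./2.
Proof.
rewrite /basis /word_comm big1_seq ?mul1r; last first.
  by move=> i; rewrite mem_enum inE /test_point => /negPf->.
have -> : [seq test_point (val J) i | i <- enum (val J)] =
          [seq ggen R i | i <- [seq val i | i <- enum (val J)]].
  rewrite -map_comp; apply/eq_in_map => i; rewrite mem_enum /test_point /=.
  by move=> ->.
by rewrite comm_prod_gen size_map -cardE //; apply: (valP J).
Qed.

Lemma basis_test_point0 (J K : evenset n) : ~~ (val K \subset val J) ->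
  basis K (test_point (val J)) = 0.
Proof.
case/subsetPn=> i iK iJ; rewrite /basis /word_comm comm_prod_1 ?mulr0 //.
  by rewrite size_map -cardE; apply: (valP K).
by apply/mapP; exists i; rewrite ?mem_enum // /test_point (negPf iJ).
Qed.

Hypothesis l_odd_or_0 : odd l \/ l = 0%N.

(** Induction on the size of K: at the test point of K, the terms of proper subsets
of K vanish by the induction hypothesis and those of sets not included in K have
a commutator with entry 1, so that only the term of K is left. *)
Lemma basis_free (c : evenset n -> int) :
  (forall x : 'I_n -> G, \sum_K basis K x *~ c K = 0) ->
  forall K, (l%:Z %| c K)%Z.
Proof.
move=> c0 K; have [m] := ubnP #|val K|; elim: m => // m IH in K *.
rewrite ltnS => Km; have := c0 (test_point (val K)).
rewrite (bigD1 K) //= big1 ?addr0 => [|J JK]; last first.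
  have [sJK|nJK] := boolP (val J \subset val K); last first.
    by rewrite basis_test_point0 // mul0rz.
  apply/grassmann_ann/IH/(leq_trans _ Km)/proper_card.
  by rewrite properEneq sJK andbT; apply: contraNneq JK => /val_inj->.
rewrite basis_test_point pmulrn -mulrzA => /prod_gen_free.
rewrite (map_inj_uniq val_inj) enum_uniq => /(_ isT) /(has_char_dvd char_l).
by rewrite mulrC -natz mulr_natr; apply: odd_dvd_pow2.
Qed.

End Independence.

(** * Multilinear polynomials *)

Lemma prodX_noconst n (i : 'I_n -> nat) : (0 < n)%N ->
  \prod_(j < n) (zx_var (i j) : ZX1) \in noconst.
Proof.
by case: n i => // n i _; rewrite big_ord_recl noconstM ?zx_valP.
Qed.

Section Multilinear.
Variable n : nat.
Hypothesis n_gt0 : (0 < n)%N.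

Definition vars (i : 'I_n) : ZX1 := zx_val (zx_var i).

Lemma rmorph_basis (A B : pzRingType) (f : {rmorphism A -> B}) (K : evenset n) x :
  f (basis K x) = basis K (f \o x).
Proof.
by rewrite /basis /word_comm rmorphM rmorph_prod rmorph_comm_prod -map_comp.
Qed.

Definition P_val (f : P_group n) : ZX1 := zx_val (val f).

Lemma P_val_zmod_morphism : zmod_morphism P_val.
Proof. by move=> f g; rewrite /P_val raddfB zx_valB. Qed.

HB.instance Definition _ :=
  GRing.isZmodMorphism.Build (P_group n) ZX1 P_val P_val_zmod_morphism.

Lemma basis_in_P (K : evenset n) : exists f : P_group n,
  P_val f = basis K vars.
Proof.
have [||c cE] := @word_comm_perm_span n (enum (~: val K)) (enum (val K)).
- apply: uniq_perm => [||i]; rewrite ?enum_uniq //.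
    rewrite cat_uniq !enum_uniq andbT; apply/hasPn => i.
    by rewrite mem_enum => iK; rewrite /= mem_enum inE iK.
  by rewrite mem_cat !mem_enum !inE orNb.
- by rewrite -cardE; apply: (valP K).
have bE := cE ZX1 I vars.
have nc : basis K vars \in noconst.
  rewrite /basis bE; apply: rpred_sum => s _; apply: rpredMz.
  exact: prodX_noconst.
have bP : MkZX nc \in P n by apply/asboolP; exists c; exact: bE.
by exists (exist _ (MkZX nc) bP).
Qed.

(** That d precedes the ring is essential: divisibility of d is established in one
ring and used in another. *)
Lemma P_normal_form (f : ZX) : f \in P n -> exists d : evenset n -> int,
  forall (Q : pzRingType) (phi : {rmorphism ZX1 -> Q}), lie_nilpotent2 Q ->
    phi (zx_val f) = \sum_K basis K (phi \o vars) *~ d K.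
Proof.
case/asboolP=> c fE.
have [d dE] : int_span lie_nilpotent2 (@basis n)
    (fun Q x => \sum_s perm_word s x *~ c s).
  by apply: (int_span_trans (@perm_word_basis_span n)); exists c.
exists d => Q phi nQ; rewrite -dE // fE raddf_sum /=; apply: eq_bigr => s _.
by rewrite raddfMz /= rmorph_prod.
Qed.

Section GrassmannIdentities.
Variables (R : comPzRingType) (l : nat).
Hypothesis char_l : has_char R l.
Hypothesis l_odd_or_0 : odd l \/ l = 0%N.
Local Notation G := (grassmann R).

Lemma basis_comb_eq0 (c : evenset n -> int) :
  (forall a : nat -> G, \sum_K basis K (ev a \o vars) *~ c K = 0) <->
  forall K, (l%:Z %| c K)%Z.
Proof.
split=> [c0|lc a]; last first.
  by rewrite big1 // => K _; apply: grassmann_ann char_l _ _ (lc K).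
apply: (basis_free char_l l_odd_or_0) => x.
(* the variables of index at least n do not occur, and receive the value 1 *)
have <- : ev (fun i => oapp x 1 (insub i)) \o vars = x; last exact: c0.
by apply/funext=> i; rewrite /= ev_var valK.
Qed.

(** The coefficients d of f are found to be divisible by l by evaluating in the
Grassmann algebra; the same d give the class of f modulo any T-ideal containing
[x,y,z], and this class vanishes as soon as the T-ideal contains l x. *)
Lemma P_Id_consequence (f : ZX) : f \in P n -> f \in Id G ->
  consequence (fun g => g = zx_comm (zx_comm (zx_var 0) (zx_var 1)) (zx_var 2)
                      \/ g = zx_var 0 *+ l) f.
Proof.
move=> Pf /asboolP f0 I TI gI.
have [d dE] := P_normal_form Pf.
have ld : forall K, (l%:Z %| d K)%Z.
  apply/basis_comb_eq0 => a; rewrite -dE; last exact: grassmann_nilpotent.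
  exact: f0.
have [Q [pi [nQ piI]]] := Tideal_quotient TI (gI _ (or_introl erefl)).
apply/piI; rewrite dE // big1 // => K _.
have [b bE] := basis_in_P K; rewrite -rmorph_basis -bE.
have /dvdzP[q ->] := ld K; rewrite mulrC mulrzA -pmulrn -raddfMn /=.
suff -> : pi (zx_val (val b) *+ l) = 0 by rewrite mul0rz.
rewrite -zx_valMn; apply/piI.
have := Tideal_endo TI (@substM (fun=> val b)) (gI _ (or_intror erefl)).
by rewrite raddfMn /= subst_var.
Qed.

Lemma P_quot_iso : exists phi :
  {additive P_quot G n -> {ffun 'I_(2 ^ (n - 1)) -> Zmod l}}, bijective phi.
Proof.
have [proj [proj_surj proj0]] := int_proj_Zmod l.
have /boolp.choice[b bE] := basis_in_P.
pose pi : P_group n -> P_quot G n := @quot_pi _ (@P_Id G n).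
have pi0 (f : P_group n) :
    pi f = 0 <-> forall a : nat -> G, ev a (P_val f) = 0.
  rewrite quot_pi_eq0; split=> [/andP[_ /asboolP] //|f0].
  by apply/andP; split; [apply: (valP f)|apply/asboolP].
have evb a (c : evenset n -> int) :
    ev a (P_val (\sum_K b K *~ c K)) = \sum_K basis K (ev a \o vars) *~ c K.
  rewrite raddf_sum raddf_sum; apply: eq_bigr => K _ /=.
  by rewrite raddfMz raddfMz /= -rmorph_basis -bE.
have pib (c : evenset n -> int) :
    \sum_K pi (b K) *~ c K = pi (\sum_K b K *~ c K).
  by rewrite /pi raddf_sum; apply: eq_bigr => K _; rewrite raddfMz.
apply: (span_iso (b := fun K => pi (b K)) (card_evenset n_gt0) proj_surj).
  elim/quot_ind=> f; have [d dE] := P_normal_form (valP f).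
  exists d; rewrite pib; apply: subr0_eq; rewrite -[X in X - _]/(pi f) -raddfB.
  apply/pi0 => a.
  rewrite [P_val _]raddfB raddfB /= evb -dE ?subrr //; exact: grassmann_nilpotent.
move=> c; rewrite pib pi0.
under eq_forall => a do rewrite evb.
by rewrite basis_comb_eq0; split=> H K; apply/proj0.
Qed.

End GrassmannIdentities.
End Multilinear.

Theorem theorem8 (R : comPzRingType) (l : nat) (char_l : has_char R l)
    (l_odd_or_0 : odd l \/ l = 0%N) :
  let G : pzRingType := grassmann R in
  let xyz : ZX := zx_comm (zx_comm (zx_var 0) (zx_var 1)) (zx_var 2) in
  let lx : ZX := zx_var 0 *+ l in
  [/\ xyz \in Id G,
      lx \in Id G,
      forall n : nat, (0 < n)%N -> forall f : ZX,
        f \in P n -> f \in Id G ->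
        consequence (fun g => g = xyz \/ g = lx) f
    & forall n : nat, (0 < n)%N ->
        exists phi : {additive P_quot G n -> {ffun 'I_(2 ^ (n - 1)) -> Zmod l}},
          bijective phi].
Proof.
move=> G xyz lx; split.
- apply/asboolP => a; rewrite zx_evalE !zx_val_comm rmorph_lie rmorph_lie.
  exact: grassmann_nilpotent.
- apply/asboolP => a; rewrite zx_evalE zx_valMn raddfMn /= ev_var.
  by rewrite pmulrn (grassmann_ann char_l).
- by move=> n n_gt0 f; apply: P_Id_consequence.
by move=> n n_gt0; apply: P_quot_iso.
Qed.
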